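(* Let $n\ge 3$ be odd and let $S\subseteq D_n$ be non-empty with $1\notin S$ and $S=S^{-1}$. If the Cayley graph $\mathrm{Cay}(D_n,S)$ is normal, then it does not exhibit PST (between any two distinct vertices, at any time).
   Context: For a finite simple graph $G$, let $\mathcal{A}(G)=\{(u,v),(v,u):\{u,v\}\in E(G)\}$ be the set of arcs; for $a=(u,v)$ put $t(a)=v$ and $\bar a=(v,u)$. The shift matrix $R\in\mathbb{C}^{\mathcal{A}(G)\times\mathcal{A}(G)}$ has $R_{a,b}=1$ if $a=\bar b$ and $0$ otherwise. The boundary matrix $N\in\mathbb{C}^{V(G)\times\mathcal{A}(G)}$ has $N_{u,a}=1/\sqrt{\deg u}$ if $t(a)=u$ and $0$ otherwise. The transition matrix of the Grover walk is $U=R(2N^*N-I)$. For a vertex $u$, $\Phi_u=N^*\mathbf{e}_u$. $G$ exhibits perfect state transfer (PST) from $u$ to another vertex $v\ne u$ at time $\tau$ ($\tau$ a positive integer) if $U^\tau\Phi_u=\gamma\Phi_v$ for some $\gamma\in\mathbb{C}$ with $|\gamma|=1$. $D_n=\langle a,b:a^n=1=b^2,\ bab=a^{-1}\rangle$ ($n\ge 2$) is the dihedral group of order $2n$. $\mathrm{Cay}(D_n,S)$ has vertex set $D_n$ and edges $\{x,y\}$ with $xy^{-1}\in S$; it is normal if $S$ is a union of conjugacy classes of $D_n$. *)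

(* Defs.v *)
From HB Require Import structures.
From mathcomp Require Import all_boot all_order all_algebra all_fingroup.
From mathcomp Require Import all_solvable spectral.
From mathcomp Require Import complex reals.

Set Implicit Arguments.
Unset Strict Implicit.
Unset Printing Implicit Defensive.

Import Order.TTheory GRing.Theory Num.Theory.
Local Open Scope ring_scope.

(* A finite simple graph is given by a symmetric irreflexive relation [e] on a
   [finType] of vertices; both properties are proved below for Cayley graphs. *)
Section GroverWalk.
Variables (C : numClosedFieldType) (V : finType) (e : rel V).

Definition arc := {p : V * V | e p.1 p.2}.

Definition arc_head (a : arc) : V := (val a).2.

(* The reversal of [a] is compared as a pair of vertices, so that it does not
   require a proof that [e] is symmetric. *)
Definition arc_rev (a : arc) : V * V := ((val a).2, (val a).1).

Definition deg (u : V) : nat := #|[set v | e u v]|.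

(* Rows and columns indexed by a finite type are numbered through [enum_val]. *)
Definition shift_mx : 'M[C]_#|{: arc}| :=
  \matrix_(i, j) (val (enum_val i) == arc_rev (enum_val j))%:R.

Definition boundary_mx : 'M[C]_(#|V|, #|{: arc}|) :=
  \matrix_(i, j) if arc_head (enum_val j) == enum_val i
                 then (sqrtC (deg (enum_val i))%:R)^-1 else 0.

Definition boundary_adj : 'M[C]_(#|{: arc}|, #|V|) :=
  (boundary_mx ^t*)%sesqui.

Definition grover_mx : 'M[C]_#|{: arc}| :=
  shift_mx *m (2%:R *: (boundary_adj *m boundary_mx) - 1%:M).

Definition vertex_state (u : V) : 'cV[C]_#|{: arc}| :=
  boundary_adj *m delta_mx (enum_rank u) 0.

Definition PST (u v : V) (tau : nat) : Prop :=
  [/\ u != v, (0 < tau)%N &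
      exists2 gamma : C, `|gamma| = 1 &
        grover_mx ^+ tau *m vertex_state u = gamma *: vertex_state v].

End GroverWalk.

Section Cayley.
Local Open Scope group_scope.
Variables (gT : finGroupType) (S : {set gT}).

Definition cayley : rel gT := fun x y => x * y^-1 \in S.

Definition normal_cayley : Prop :=
  exists2 P : {set {set gT}}, P \subset classes [set: gT] & S = cover P.

Lemma cayley_sym : S^-1 = S -> symmetric cayley.
Proof.
by move=> SV x y; rewrite /cayley -[in LHS]SV inE invMg invgK.
Qed.

Lemma cayley_irr : 1 \notin S -> irreflexive cayley.
Proof. by move=> S1 x; rewrite /cayley mulgV (negbTE S1). Qed.

End Cayley.

(* The library indexes dihedral groups by their order. *)
Definition dihedral (n : nat) : finGroupType := 'D_(n.*2)%type.

Lemma dihedral_presentation (n : nat) : (1 < n)%N ->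
  ([set: dihedral n] \isog Grp (x : y : x ^+ n, y ^+ 2, x ^ y = x^-1))%g.
Proof. exact: Grp_dihedral. Qed.

(* Main.v *)
Require Import Defs.
From mathcomp Require Import all_boot all_order all_algebra all_fingroup.
From mathcomp Require Import all_solvable complex reals.

(** The obstruction is symmetry.  An automorphism sigma of a graph permutes
    its arcs, and the resulting permutation of the standard basis commutes with
    the transition matrix U of the Grover walk and carries the state of a vertex
    x to the state of sigma x.  Suppose U^tau maps the state of u to a multiple gamma of the
    state of v.  If sigma fixes u, then U^tau also maps the state of u to gamma
    times the state of sigma v; since gamma is non-zero and distinct
    non-isolated vertices have distinct states, sigma fixes v as well
    ([PST_fixed]).

    In a normal Cayley graph the maps x |-> (x u^-1)^g u are automorphisms,
    because the connection set is stable under conjugation, and they all fix u.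
    Hence they fix v, which says that v u^-1 is central
    ([normal_cayley_PST_central]).  For odd n the centre of the dihedral group
    of order 2n is trivial ([center_dihedral_odd]), so v = u, whereas perfect
    state transfer requires distinct vertices. *)

Set Implicit Arguments.
Unset Strict Implicit.
Unset Printing Implicit Defensive.

Import GRing.Theory Num.Theory.

Lemma perm_mx_intertwine (R : pzRingType) (m n : nat)
    (s : 'S_m) (t : 'S_n) (M : 'M[R]_(m, n)) :
  (forall i j, M (s i) (t j) = M i j) ->
  (perm_mx s *m M = M *m perm_mx t)%R.
Proof.
move=> sMt; rewrite -row_permE -[t]invgK -col_permE.
by apply/matrixP=> i j; rewrite !mxE -{1}(permKV t j) sMt.
Qed.

Section Equivariance.
Local Open Scope ring_scope.
Variables (C : numClosedFieldType) (V : finType) (e : rel V).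

Variable sigma : {perm V}.
Hypothesis sigma_aut : forall x y, e (sigma x) (sigma y) = e x y.

Let sigma_arc (a : Defs.arc e) :
  e (sigma (val a).1, sigma (val a).2).1
    (sigma (val a).1, sigma (val a).2).2.
Proof. by rewrite sigma_aut; case: a. Qed.

Let arc_map (a : Defs.arc e) : Defs.arc e := Sub _ (sigma_arc a).

Let arc_map_inj : injective arc_map.
Proof.
move=> [[x y] xy] [[z w] zw] [/perm_inj xz /perm_inj yw].
by apply/val_inj; rewrite /= xz yw.
Qed.

Let rank_map_inj (T : finType) (f : T -> T) : injective f ->
  injective (fun i : 'I_#|T| => enum_rank (f (enum_val i))).
Proof. by move=> f_inj i j /enum_rank_inj/f_inj/enum_val_inj. Qed.

Let vertex_perm : 'S_#|V| := perm (rank_map_inj (@perm_inj _ sigma)).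
Let arc_perm : 'S_#|{: Defs.arc e}| := perm (rank_map_inj arc_map_inj).

Let val_vertex_perm i : enum_val (vertex_perm i) = sigma (enum_val i).
Proof. by rewrite permE enum_rankK. Qed.

Let val_arc_perm i : enum_val (arc_perm i) = arc_map (enum_val i).
Proof. by rewrite permE enum_rankK. Qed.

Lemma deg_aut u : deg e (sigma u) = deg e u.
Proof.
rewrite /deg -[RHS](card_imset _ (@perm_inj _ sigma)); congr #|pred_of_set _|.
apply/setP=> v; rewrite -[v](permKV sigma).
by rewrite (mem_imset _ _ (@perm_inj _ sigma)) !inE sigma_aut.
Qed.

Lemma shift_aut :
  perm_mx arc_perm *m shift_mx C e = shift_mx C e *m perm_mx arc_perm.
Proof.
apply: perm_mx_intertwine => i j; rewrite !mxE !val_arc_perm /arc_rev /=.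
by case: (val _) => x y; rewrite !xpair_eqE !(inj_eq (@perm_inj _ sigma)).
Qed.

Let boundary_entry i j :
  boundary_mx C e (vertex_perm i) (arc_perm j) = boundary_mx C e i j.
Proof.
rewrite !mxE val_vertex_perm val_arc_perm deg_aut /arc_head /=.
by rewrite (inj_eq (@perm_inj _ sigma)).
Qed.

Lemma boundary_aut :
  perm_mx vertex_perm *m boundary_mx C e = boundary_mx C e *m perm_mx arc_perm.
Proof. exact: perm_mx_intertwine boundary_entry. Qed.

Lemma boundary_adj_aut :
  perm_mx arc_perm *m boundary_adj C e = boundary_adj C e *m perm_mx vertex_perm.
Proof.
apply: perm_mx_intertwine => i j.
by rewrite [LHS]mxE [RHS]mxE ![(_^T)%R _ _]mxE boundary_entry.
Qed.

Lemma grover_aut : GRing.comm (perm_mx arc_perm) (grover_mx C e).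
Proof.
apply: commrM; first exact: shift_aut.
apply: commrB; last exact: commr1.
rewrite /GRing.comm /GRing.mul /=.
by rewrite -scalemxAr -scalemxAl mulmxA boundary_adj_aut -!mulmxA boundary_aut.
Qed.

(** [perm_mx] acts on column vectors by the inverse permutation, so the arc
    matrix undoes sigma on vertex states. *)
Lemma vertex_state_aut u :
  perm_mx arc_perm *m vertex_state C e (sigma u) = vertex_state C e u.
Proof.
rewrite /vertex_state mulmxA boundary_adj_aut -mulmxA; congr (_ *m _).
rewrite -row_permE; apply/matrixP=> i j; rewrite !mxE.
by rewrite -(inj_eq enum_val_inj) val_vertex_perm enum_rankK
   (inj_eq (@perm_inj _ sigma)) -(inj_eq enum_val_inj) enum_rankK.
Qed.

(** The arc from w to v separates the two states: the state of v is non-zero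
    there, and every other vertex state vanishes there.  An isolated vertex, on
    the contrary, has state 0. *)
Lemma vertex_state_inj u v w : symmetric e -> e v w ->
  vertex_state C e u = vertex_state C e v -> u = v.
Proof.
move=> e_sym evw.
have Phi_entry x i : vertex_state C e x i 0 =
    (if arc_head (enum_val i) == x then (sqrtC (deg e x)%:R)^-1 else 0)^*.
  by rewrite /vertex_state -colE !mxE enum_rankK.
have ewv : e (w, v).1 (w, v).2 by rewrite /= e_sym.
move/matrixP/(_ (enum_rank (Sub (w, v) ewv)) 0).
rewrite !Phi_entry !enum_rankK /arc_head /= eqxx.
case: eqP => // _ /esym/eqP.
rewrite conjC0 conjC_eq0 invr_eq0 sqrtC_eq0 pnatr_eq0 /deg cards_eq0.
by move/eqP/setP/(_ w); rewrite !inE evw.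
Qed.

(** Both the walk and the initial state are invariant under an automorphism that
    fixes u; the target state is then invariant too, and it determines v. *)
Lemma PST_fixed u v w tau : symmetric e -> e v w ->
  PST C e u v tau -> sigma u = u -> sigma v = v.
Proof.
move=> e_sym evw [_ _ [gamma gamma1 Uuv]] fix_u.
have gamma0 : gamma != 0 by rewrite -normr_eq0 gamma1 oner_eq0.
have := commrX tau grover_aut.
move/(congr1 (fun M => M *m vertex_state C e u)).
rewrite -!mulmxE -!mulmxA -{2}fix_u vertex_state_aut Uuv -scalemxAr.
move/(scalerI gamma0); rewrite -{2}(vertex_state_aut v).
move/(congr1 (mulmx (invmx (perm_mx arc_perm)))).
rewrite !mulKmx ?unitmx_perm // => Phi_v.
by apply: (vertex_state_inj e_sym evw).
Qed.

End Equivariance.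

Section NormalCayley.
Local Open Scope group_scope.
Variables (gT : finGroupType) (S : {set gT}).

Lemma normal_cayleyJ (x g : gT) : normal_cayley S -> (x ^ g \in S) = (x \in S).
Proof.
case=> P /subsetP P_classes ->.
suff sub y h : y \in cover P -> y ^ h \in cover P.
  by apply/idP/idP => [/(sub _ g^-1)|/sub]; [rewrite conjgK|apply].
case/bigcupP=> B PB yB; apply/bigcupP; exists B => //.
have /imsetP[z _ BE] := P_classes _ PB; rewrite BE in yB *.
by rewrite -(class_eqP yB) memJ_class ?inE.
Qed.

(** Translating by u turns conjugation by g into a graph automorphism that fixes
    u.  It must then fix v as well, for every g. *)
Lemma normal_cayley_PST_central (C : numClosedFieldType) u v tau :
  S != set0 -> S^-1 = S -> normal_cayley S ->
  PST C (cayley S) u v tau -> v * u^-1 \in 'Z([set: gT]).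
Proof.
move=> /set0Pn[s Ss] SV normS uv.
apply/centerP; split=> [|g _]; first by rewrite inE.
have f_inj : injective (fun x => (x * u^-1) ^ g * u).
  by move=> x y /mulIg/conjg_inj/mulIg.
have f_aut x y : cayley S (perm f_inj x) (perm f_inj y) = cayley S x y.
  rewrite /cayley !permE invMg mulgA mulgK -conjVg -conjMg normal_cayleyJ //.
  by rewrite invMg invgK mulgA mulgKV.
have evw : cayley S v (s^-1 * v) by rewrite /cayley invMg mulgA mulgV mul1g invgK.
have := PST_fixed f_aut (cayley_sym SV) evw uv.
rewrite !permE mulgV conj1g mul1g => /(_ erefl) /(canRL (mulgK u)) vJ.
by apply/commgP/conjg_fixP.
Qed.

End NormalCayley.

Section Dihedral.
Local Open Scope group_scope.

(** Write z = x^i y^j in terms of a rotation x and a reflection y.  If z is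
    central and j is odd, then y commutes with x; if j is even, then y commutes
    with z = x^i.  Since y inverts rotations, in each case a rotation is its own
    inverse, hence trivial because its order divides the odd number n.  In the
    first case that rotation is x itself, and the group would have order at
    most 2. *)
Lemma center_dihedral_odd n : 1 < n -> odd n -> 'Z([set: dihedral n]) = 1.
Proof.
move=> n_gt1 n_odd.
have := isoGrp_hom (dihedral_presentation n_gt1).
case/existsP=> -[x y] /= /eqP[defG xn y2 xy].
have{} defG: <[x]> * <[y]> = [set: dihedral n].
  by rewrite -norm_joinEr // norms_cycle xy groupV cycle_id.
have rot_invol1 i : (x ^+ i) ^+ 2 = 1 -> x ^+ i = 1.
  move=> xi2; apply/eqP; rewrite -order_eq1 -dvdn1.
  have <- : gcdn 2 n = 1%N by apply/eqP; rewrite -/(coprime 2 n) coprime2n.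
  by rewrite dvdn_gcd !order_dvdn xi2 -expgM mulnC expgM xn expg1n !eqxx.
have x_neq1 : x != 1.
  have card_xy : #|<[x]> * <[y]>| = n.*2 by rewrite defG; apply: card_dihedral.
  apply/eqP=> x1; move: n_gt1; rewrite ltnNge => /negP; apply.
  rewrite -leq_double -card_xy.
  by rewrite x1 cycle1 mul1g -orderE dvdn_leq // order_dvdn y2.
apply/trivgP/subsetP=> z /centerP[_ zC].
have : z \in <[x]> * <[y]> by rewrite defG inE.
case/mulsgP=> _ _ /cycleP[i ->] /cycleP[j ->] zE.
have fix_invol t : t ^ y = t^-1 -> t ^ y = t -> t ^+ 2 = 1.
  by move=> ty tt; rewrite expgS expg1 -[X in X * _]tt ty mulVg.
have yj : y ^+ j = y ^+ odd j.
  by rewrite -{1}(odd_double_half j) expgD -mul2n expgM y2 expg1n mulg1.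
rewrite yj in zE; case: (odd j) zE => [zE|].
  case/eqP: x_neq1; rewrite -(expg1 x); apply: rot_invol1.
  apply: fix_invol; rewrite expg1 //; apply/conjg_fixP/commgP.
  have xz : commute x (x ^+ i * y).
    by rewrite -zE; apply/commute_sym/zC; rewrite inE.
  rewrite -(mulKg (x ^+ i) y).
  by apply: commuteM => //; apply/commuteV/commuteX.
rewrite mulg1 => zE; rewrite inE zE; apply/eqP/rot_invol1/fix_invol.
  by rewrite conjXg xy expgVn.
by apply/conjg_fixP/commgP; rewrite -zE; apply: zC; rewrite inE.
Qed.

End Dihedral.

Theorem theorem4p6 (R : realType) (n : nat) (S : {set dihedral n}) :
  (3 <= n)%N -> odd n ->
  S != set0 -> (1 \notin S)%g -> (S^-1 = S)%g ->
  normal_cayley S ->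
  forall (u v : dihedral n) (tau : nat), ~ PST (R[i])%C (cayley S) u v tau.
Proof.
move=> n_ge3 n_odd S0 _ SV normS u v tau uv.
have := normal_cayley_PST_central S0 SV normS uv.
rewrite center_dihedral_odd ?(ltnW n_ge3) // => /set1P vu1.
have [/eqP[]] := uv.
by rewrite -[LHS]mul1g -vu1 mulgKV.
Qed.
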